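(* Let $(\Omega,\mathscr{F},(\mathbb{P}_x)_{x\in\mathbb{R}^d};(X_t)_{t\ge0})$ be a family of $\mathbb{R}^d$-valued time-homogeneous Markov processes. Let $f$ be a nonnegative measurable function on $\mathbb{R}^d$. For given $T,R>0$, if $$\sup_{|x|\le R}\mathbb{E}_x\Big(\int_0^Tf(X_t)1_{|X_t|\le R}\,dt\Big)=:c<1,$$ then for all $x\in\mathbb{R}^d$, $$\mathbb{E}_x\exp\Big\{\int_0^Tf(X_t)1_{|X_t|\le R}\,dt\Big\}\le1+\frac{1}{1-c}\,\mathbb{E}_x\Big(\int_0^Tf(X_t)1_{|X_t|\le R}\,dt\Big).$$
   Context: $\mathbb{E}_x$ denotes the expectation with respect to $\mathbb{P}_x$, the law under which the process starts from $x$. *)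

(* Defs.v *)
From HB Require Import structures.
From mathcomp Require Import all_boot all_order all_algebra.
From mathcomp Require Import all_classical all_reals all_analysis.
From mathcomp Require Import measurable_realfun.

Set Implicit Arguments.
Unset Strict Implicit.
Unset Printing Implicit Defensive.

Import Order.TTheory GRing.Theory Num.Theory.
Import numFieldNormedType.Exports.

Local Open Scope classical_set_scope.
Local Open Scope ring_scope.

(* [R^d] with its Borel sigma-algebra.  The carrier is convertible to
   ['rV[R]_d]; the library topology on it comes from the sup norm and is the
   usual one. *)
Notation borel_space R d := (g_sigma_algebraType (@open 'rV[R]_d)).

(* The library norm on ['rV[R]_d] is the sup norm, hence this definition. *)
Definition euclidean_norm (R : realType) (d : nat) (x : borel_space R d) : R :=
  Num.sqrt (\sum_(i < d) (x : 'rV[R]_d) ord0 i ^+ 2).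

Definition euclidean_ball (R : realType) (d : nat) (r : R) :
    set (borel_space R d) :=
  [set x | euclidean_norm x <= r].

Section markov.
Context (dO : measure_display) (Omega : measurableType dO) (R : realType)
  (dE : measure_display) (E : measurableType dE).

(* Processes are indexed by [R]; only the times [0 <= t] are constrained. *)
Implicit Type X : R -> Omega -> E.

Definition natural_filtration X (t : R) : set (set Omega) :=
  <<s \bigcup_(s in `[0, t]) preimage_set_system setT (X s) measurable >>.

(* [Y] is a version of the conditional probability [mu(A | G)], for a
   sub-sigma-algebra [G]; in that case [<<s G >> = G], so that the first
   condition is the [G]-measurability of [Y]. *)
Definition is_cond_prob (mu : {measure set Omega -> \bar R})
    (G : set (set Omega)) (A : set Omega) (Y : Omega -> \bar R) : Prop :=
  measurable_fun setT (Y : g_sigma_algebraType G -> \bar R) /\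
  (forall D, G D -> (\int[mu]_(w in D) Y w)%E = mu (D `&` A)).

(* That [x |-> P x A] is measurable for every event [A] is part of the
   structure of [P] as a probability kernel. *)
Definition homogeneous_markov (P : R.-pker E ~> Omega) X : Prop :=
  [/\ forall t, 0 <= t -> measurable_fun setT (X t),
      forall x, P x [set w | X 0 w = x] = 1%E
    & forall x (s t : R) (B : set E), 0 <= s -> 0 <= t -> measurable B ->
        is_cond_prob (P x) (natural_filtration X s) (X (s + t) @^-1` B)
          (fun w => P (X s w) (X t @^-1` B))].

(* Joint measurability of [(t, w) |-> X_t(w)] on [[0, +oo[ * Omega], which
   makes time integrals along the paths random variables. *)
Definition measurable_process X : Prop :=
  @measurable_fun _ _ (measurableTypeR R * Omega)%type E
    (`[0, +oo[ `*` [set: Omega]) (fun p => X p.1 p.2).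

End markov.

(* [\int_0^T f(X_t) 1_{|X_t| <= r} dt], valued in [[0, +oo]]. *)
Definition ball_occupation (R : realType) (d : nat) (Omega : Type)
    (X : R -> Omega -> borel_space R d) (f : borel_space R d -> R) (T r : R)
    (w : Omega) : \bar R :=
  (\int[lebesgue_measure]_(t in `[0%R, T])
     (f (X t w) * \1_(@euclidean_ball R d r) (X t w))%:E)%E.

(* Main.v *)
Require Import Defs.
From HB Require Import structures.
From mathcomp Require Import all_boot all_order all_algebra.
From mathcomp Require Import all_classical all_reals all_analysis.
From mathcomp Require Import measurable_realfun.

(** This is Khasminskii's lemma.  Put [g := f * 1_ball], which is nonnegative, and
    let [A] be the integral of [g (X t)] over [0 <= t <= T].  The power
    [A ^+ n / n`!] is the integral [J n T] of [g (X t1) * ... * g (X tn)] over the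
    simplex [t1 <= ... <= tn <= T], so that [expeR A] is the sum of the [J n T]
    ([expeR_iterated_integral]).  In [J n.+2 T], integrate first over the latest
    time [t], which runs from the previous time [s] to [T].  The weight [g (X s)] is
    zero unless [X s] lies in the ball, and then the Markov property at time [s]
    bounds the conditional expectation of the integral of [g (X t)] over
    [s <= t <= T] by the supremum [c].  Hence the expectation of [J n.+2 T] is at
    most [c] times that of [J n.+1 T] ([iterated_integral_expectation_le]), and
    summing the geometric series gives the bound.  The starting point [x] is
    arbitrary since the supremum is only used at the later position [X s].

    All quantities are nonnegative extended reals, so that Tonelli and monotone
    convergence apply throughout without truncating [f] and without integrability.
    In particular the identity between powers and simplex integrals comes from
    Tonelli on a square cut along its diagonal ([ge0_integralM_by_parts]) and not
    from differentiation.

    The delicate point is that the path functional [J n s] of the past need not be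
    measurable for the natural filtration at time [s], since the process is only
    assumed jointly measurable.  The Markov property is therefore applied for fixed
    integration times, where products of the [g (X u)] are measurable with respect
    to the past, and integrated afterwards ([markov_iterated_integral]). *)

Set Implicit Arguments.
Unset Strict Implicit.
Unset Printing Implicit Defensive.

Import Order.TTheory GRing.Theory Num.Theory.
Import numFieldNormedType.Exports.

Local Open Scope classical_set_scope.
Local Open Scope ring_scope.
Local Open Scope ereal_scope.

(** * Integrals over subintervals and the integration by parts formula *)

Lemma measurable_le_set d (T : measurableType d) (R : realType)
    (f g : T -> measurableTypeR R) :
  measurable_fun setT f -> measurable_fun setT g ->
  measurable [set p | (f p <= g p)%R].
Proof.
move=> mf mg; rewrite -[X in measurable X]setTI.
by rewrite -preimage_true; exact: measurable_fun_ler.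
Qed.

Section triangle.
Context (R : realType).
Local Notation mu := (@lebesgue_measure R).
Local Notation mR := (measurableTypeR R).

Let triangle (T : R) : set (mR * mR) :=
  [set p | (0 <= p.1)%R /\ (p.1 <= p.2)%R /\ (p.2 <= T)%R].

Let measurable_triangle T : measurable (triangle T).
Proof.
have mfst : measurable_fun setT (fst : mR * mR -> mR) by exact: measurable_fst.
have msnd : measurable_fun setT (snd : mR * mR -> mR) by exact: measurable_snd.
apply: measurableI; last apply: measurableI.
- by apply: (measurable_le_set (f := cst 0%R)).
- exact: measurable_le_set mfst msnd.
- by apply: (measurable_le_set (g := cst T)).
Qed.

(** Tonelli's theorem on the triangle [0 <= s <= t <= T].  It is used twice:
    pathwise, for the integration by parts formula, and to rewrite an iterated
    integral so that its two latest times come as a time [s] followed by a later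
    time [t]. *)
Lemma ge0_integral_triangle (k : mR * mR -> \bar R) (T : R) :
  measurable_fun setT k -> (forall p, 0 <= k p) ->
  \int[mu]_(t in `[0%R, T]) \int[mu]_(s in `[0%R, t]) k (s, t) =
  \int[mu]_(s in `[0%R, T]) \int[mu]_(t in `[s, T]) k (s, t).
Proof.
move=> mk k0; set D := triangle T.
have mkD : measurable_fun setT (k \_ D).
  by apply/(measurable_restrictT _ (measurable_triangle T)); exact: measurable_funS mk.
have kD0 p : 0 <= (k \_ D) p by rewrite patchE; case: ifP.
transitivity (\int[mu]_t \int[mu]_s (k \_ D) (s, t)).
  rewrite integral_mkcond; apply: eq_integral => t _.
  rewrite patchE; case: ifPn; rewrite ?inE ?notin_setE /= in_itv /=.
    move=> /andP[t0 tT].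
    rewrite integral_mkcond; apply: eq_integral => s _.
    rewrite !patchE; congr (if _ then _ else _).
    rewrite /D /triangle.
    apply/idP/idP; rewrite !inE/= in_itv/=; last by move=> [-> []->].
    by move=> /andP[-> ->].
  move=> h; rewrite integral0_eq// => s _; rewrite patchE; case: ifPn => //.
  rewrite inE /D /triangle/= => -[s0 [st tT]]; exfalso; apply: h.
  by rewrite tT (le_trans s0 st).
rewrite -(fubini_tonelli _ mkD kD0).
rewrite [RHS]integral_mkcond; apply: eq_integral => s _.
rewrite patchE; case: ifPn; rewrite ?inE ?notin_setE /= in_itv /=.
  move=> /andP[s0 sT].
  rewrite [RHS]integral_mkcond; apply: eq_integral => t _.
  rewrite !patchE; congr (if _ then _ else _).
  rewrite /D /triangle.
  apply/idP/idP; rewrite !inE/= in_itv/=; first by move=> [_ [-> ->]].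
  by move=> /andP[-> ->].
move=> h; rewrite integral0_eq// => t _; rewrite patchE; case: ifPn => //.
rewrite inE /D /triangle/= => -[s0 [st tT]]; exfalso; apply: h.
by rewrite s0 (le_trans st tT).
Qed.

End triangle.

(** The domain of integration is a section of a measurable set of pairs, so that
    one statement covers both the intervals [[0, t]] and [[t, T]] whose endpoint
    moves with the parameter. *)
Lemma measurable_fun_integral_section d (T : measurableType d) (R : realType)
    (D : set (T * measurableTypeR R)) (F : T * measurableTypeR R -> \bar R) :
  measurable D -> measurable_fun setT F -> (forall p, 0 <= F p) ->
  measurable_fun setT
    (fun x => \int[lebesgue_measure]_(s in [set s | D (x, s)]) F (x, s)).
Proof.
move=> mD mF F0.
have mk : measurable_fun setT (F \_ D).
  apply/(measurable_restrictT _ mD); exact: (@measurable_funS _ _ _ _ setT).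
have k0 q : 0 <= (F \_ D) q by rewrite patchE; case: ifP.
rewrite (_ : (fun x => _) = fubini_F lebesgue_measure (F \_ D)).
  by apply: measurable_fun_fubini_tonelli_F.
apply/funext => x /=; rewrite /fubini_F [LHS]integral_mkcond/=; apply: eq_integral => s _.
by rewrite !patchE; congr (if _ then _ else _); apply/idP/idP; rewrite !inE.
Qed.

Lemma measurable_fun_primitive d (T : measurableType d) (R : realType)
    (F : measurableTypeR R * T -> \bar R) :
  measurable_fun setT F -> (forall p, 0 <= F p) ->
  measurable_fun setT (fun p : measurableTypeR R * T =>
    \int[lebesgue_measure]_(s in `[0%R, p.1]) F (s, p.2)).
Proof.
move=> mF F0.
pose D : set ((measurableTypeR R * T) * measurableTypeR R) :=
  [set q | (0 <= q.2)%R] `&` [set q | (q.2 <= q.1.1)%R].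
rewrite (_ : (fun p => _) = (fun p => \int[lebesgue_measure]_(s in
    [set s | D (p, s)]) (fun q => F (q.2, q.1.2)) (p, s))); last first.
  apply/funext => p; congr integral; apply/seteqP; split => s /=.
    by rewrite in_itv/= => /andP[].
  by rewrite in_itv/= /D => -[/= -> ->].
apply: (@measurable_fun_integral_section _ _ _ D (fun q => F (q.2, q.1.2))) => //.
  apply: measurableI.
    by apply: (measurable_le_set (f := cst 0%R)) => //; exact: measurable_snd.
  apply: measurable_le_set; first exact: measurable_snd.
  by apply: measurableT_comp; [exact: measurable_fst|exact: measurable_fst].
apply: (measurableT_comp mF).
apply/measurable_fun_pair => /=; first exact: measurable_snd.
by apply: measurableT_comp; [exact: measurable_snd|exact: measurable_fst].
Qed.

Section product_rule.
Context (R : realType).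
Local Notation mu := (@lebesgue_measure R).
Local Notation mR := (measurableTypeR R).
Variables u v : mR -> \bar R.
Hypotheses (measurable_u : measurable_fun setT u) (measurable_v : measurable_fun setT v).
Hypotheses (u0 : forall t, 0 <= u t) (v0 : forall t, 0 <= v t).

(** The square [[0, T]^2] splits into the triangles [s <= t] and [t <= s]; each
    integral on the right is the product density [u s * v t] integrated over one
    of them.  As an identity between extended reals it also covers infinite
    integrals. *)
Lemma ge0_integralM_by_parts (T : R) :
  (\int[mu]_(t in `[0%R, T]) u t) * (\int[mu]_(t in `[0%R, T]) v t) =
  \int[mu]_(t in `[0%R, T]) ((\int[mu]_(s in `[0%R, t]) u s) * v t) +
  \int[mu]_(t in `[0%R, T]) (u t * (\int[mu]_(s in `[0%R, t]) v s)).
Proof.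
have mprim (f : mR -> \bar R) : measurable_fun setT f -> (forall t, 0 <= f t) ->
    measurable_fun setT (fun t : mR => \int[mu]_(s in `[0%R, t]) f s).
  move=> mf f0.
  have mp := measurable_fun_primitive (F := fun p : mR * mR => f p.1)
    (measurableT_comp mf measurable_fst) (fun p => f0 p.1).
  apply: (measurableT_comp mp (g := fun t : mR => (t, t))).
  exact: measurable_fun_pair.
have int0 (f : mR -> \bar R) (D : set R) : (forall t, 0 <= f t) -> 0 <= \int[mu]_(s in D) f s.
  by move=> f0; apply: integral_ge0.
rewrite -ge0_integralZl//; last 2 first.
- exact: measurable_funTS.
- exact: int0.
transitivity (\int[mu]_(t in `[0%R, T]) ((\int[mu]_(s in `[0%R, t]) u s) * v t +
    \int[mu]_(s in `[t, T]) (u s * v t))).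
  apply: eq_integral => t; rewrite inE/= in_itv/= => /andP[t0 tT].
  rewrite ge0_integralZr//; last exact: measurable_funTS.
  rewrite -ge0_muleDl ?int0//; congr (_ * _).
  rewrite -(@integral_itv_obnd_cbnd _ t); last exact: measurable_funTS.
  rewrite -ge0_integral_setU//=.
  - by rewrite -itv_bndbnd_setU// bnd_simp.
  - exact: measurable_funTS.
  - apply/disj_setPS => s []/=; rewrite !in_itv/= => /andP[_ st] /andP[].
    by rewrite ltNge st.
have mswap : measurable_fun setT (fun t : mR => \int[mu]_(s in `[t, T]) (u s * v t)).
  rewrite (_ : (fun t => _) = (fun t => \int[mu]_(s in
    [set s | ([set q : mR * mR | q.1 <= q.2]%R `&` [set q | q.2 <= T]%R) (t, s)])
      (fun q : mR * mR => u q.2 * v q.1) (t, s))); last first.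
    apply/funext => t; congr integral; apply/seteqP; split => s /=.
      by rewrite in_itv/= => /andP[].
    by rewrite in_itv/= => -[/= -> ->].
  apply: (@measurable_fun_integral_section _ mR R
    ([set q | (q.1 <= q.2)%R] `&` [set q | (q.2 <= T)%R])
    (fun q => u q.2 * v q.1)).
  - apply: measurableI.
      by apply: measurable_le_set; [exact: measurable_fst|exact: measurable_snd].
    by apply: (measurable_le_set (g := cst T)) => //; exact: measurable_snd.
  - by apply: emeasurable_funM; apply: measurableT_comp.
  - by move=> p; exact: mule_ge0.
rewrite ge0_integralD//.
- congr (_ + _).
  rewrite -(@ge0_integral_triangle _ (fun p => u p.2 * v p.1)).
  + apply: eq_integral => t _; rewrite -ge0_integralZl//.
    exact: measurable_funTS.
  + by apply: emeasurable_funM; apply: measurableT_comp.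
  + by move=> p; exact: mule_ge0.
- by move=> t _; rewrite mule_ge0// int0.
- by apply: measurable_funTS; apply: emeasurable_funM => //; exact: mprim.
- by move=> t _; rewrite int0// => s; exact: mule_ge0.
- exact: measurable_funTS.
Qed.

End product_rule.

(** * Iterated integrals and the exponential series *)

(** The integral of [h s1 * ... * h sn] over the simplex
    [0 <= s1 <= ... <= sn <= t]; the recursion peels off the latest time [sn]. *)
Fixpoint iterated_integral (R : realType) (h : measurableTypeR R -> \bar R)
    (n : nat) (t : R) : \bar R :=
  if n is n'.+1
  then \int[lebesgue_measure]_(s in `[0%R, t]) (iterated_integral h n' s * h s)
  else 1.

Section iterated_integral.
Context (R : realType).
Local Notation mu := (@lebesgue_measure R).
Local Notation mR := (measurableTypeR R).

Lemma iterated_integral_ge0 (h : mR -> \bar R) n t :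
  (forall s, 0 <= h s) -> 0 <= iterated_integral h n t.
Proof.
move=> h0; elim: n t => [//|n ih] t /=.
by apply: integral_ge0 => s _; exact: mule_ge0.
Qed.

Lemma iterated_integral1 (h : mR -> \bar R) t :
  iterated_integral h 1 t = \int[mu]_(s in `[0%R, t]) h s.
Proof. by apply: eq_integral => s _; rewrite mul1e. Qed.

Lemma measurable_iterated_integral d (T : measurableType d)
    (H : mR * T -> \bar R) n :
  measurable_fun setT H -> (forall p, 0 <= H p) ->
  measurable_fun setT
    (fun p : mR * T => iterated_integral (fun s => H (s, p.2)) n p.1).
Proof.
move=> mH H0; elim: n => [|n ih]; first exact: measurable_cst.
apply: (measurable_fun_primitive
  (F := fun p => iterated_integral (fun s => H (s, p.2)) n p.1 * H p)).
- exact: emeasurable_funM.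
- by move=> p; rewrite mule_ge0// iterated_integral_ge0.
Qed.

Section exponential.
Variable h : mR -> \bar R.
Hypothesis mh : measurable_fun setT h.
Hypothesis h0 : forall s, 0 <= h s.

Let miter n : measurable_fun setT (iterated_integral h n : mR -> \bar R).
Proof.
have mp := @measurable_iterated_integral _ mR (fun p => h p.1) n
  (measurableT_comp mh measurable_fst) (fun p => h0 p.1).
apply: (measurableT_comp mp (g := fun t : mR => (t, t))).
exact: measurable_fun_pair.
Qed.

(** Integration by parts of [iterated_integral h n.+1] against the primitive of
    [h] produces the next iterated integral plus, by induction, [n.+1] copies of
    it. *)
Lemma iterated_integralSM n t :
  n.+1%:R%:E * iterated_integral h n.+1 t =
  iterated_integral h n t * iterated_integral h 1 t.
Proof.
have ii0 m s : 0 <= iterated_integral h m s by exact: iterated_integral_ge0.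
elim: n t => [t|n ih t]; first by rewrite !mul1e.
rewrite iterated_integral1 [in RHS]/= ge0_integralM_by_parts//; last 2 first.
- exact: emeasurable_funM.
- by move=> s; exact: mule_ge0.
under [X in _ = _ + X]eq_integral do
  rewrite -iterated_integral1 muleAC -ih -muleA.
rewrite ge0_integralZl//; last 2 first.
- by apply: measurable_funTS; exact: emeasurable_funM.
- by move=> s _; exact: mule_ge0.
by rewrite -[n.+2]add1n natrD EFinD ge0_muleDl// mul1e.
Qed.

Lemma iterated_integral_fin n t a : iterated_integral h 1 t = a%:E ->
  iterated_integral h n t = (a ^+ n / n`!%:R)%:E.
Proof.
move=> ha; elim: n => [|n ih]; first by rewrite /= expr0 fact0 divr1.
have := iterated_integralSM n t; rewrite ha ih.
have := iterated_integral_ge0 n.+1 t h0.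
case: (iterated_integral h n.+1 t) => [b|_|//]; last first.
  by rewrite mulry gtr0_sg// mul1e.
move=> _ [/(congr1 (fun z => n.+1%:R^-1 * z)%R)]; rewrite mulrA mulVf ?mul1r//.
move=> ->; congr EFin.
rewrite exprSr factS natrM invfM [LHS]mulrC -!mulrA; congr (_ * _)%R.
by rewrite mulrCA; congr (_ * _)%R; rewrite mulrC.
Qed.

(** The [n]-th iterated integral is [a ^+ n / n`!], with [a] the integral of
    [h], so this is the exponential series.  If [a] is infinite both sides are, by
    the term of index 1. *)
Lemma expeR_iterated_integral t :
  expeR (\int[mu]_(s in `[0%R, t]) h s) = \sum_(n <oo) iterated_integral h n t.
Proof.
rewrite -iterated_integral1.
have := iterated_integral_ge0 1 t h0.
case E : (iterated_integral h 1 t) => [a| |] // _.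
  rewrite /=.
  transitivity (\sum_(n <oo) (exp_coeff a n)%:E).
    rewrite /expR -EFin_lim; last exact: is_cvg_series_exp_coeff.
    by congr (limn _); apply/funext => n; rewrite /= /series/= sumEFin.
  by apply: eq_eseriesr => n _; rewrite (iterated_integral_fin _ E).
rewrite /=; apply/esym/eqP; rewrite -leye_eq -E.
apply: le_trans (nneseries_lim_ge 2 _).
  by rewrite big_nat_recl// big_nat1 leeDr.
by move=> n _ _; exact: iterated_integral_ge0.
Qed.

End exponential.

End iterated_integral.

(** * Induction over measurable functions and Fubini for kernels *)

Section function_induction.
Import HBNNSimple.

(** Indicators, sums, multiples and increasing limits reach every nonnegative
    measurable function, through its approximation by simple functions. *)
Lemma ge0_measurable_fun_ind d (T : measurableType d) (R : realType)
    (Q : (T -> \bar R) -> Prop) :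
  (forall A, measurable A -> Q (fun x => (\1_A x)%:E)) ->
  (forall f g, measurable_fun setT f -> (forall x, 0 <= f x) ->
    measurable_fun setT g -> (forall x, 0 <= g x) ->
    Q f -> Q g -> Q (fun x => f x + g x)) ->
  (forall k f, (0 <= k)%R -> measurable_fun setT f -> (forall x, 0 <= f x) ->
    Q f -> Q (fun x => k%:E * f x)) ->
  (forall f : (T -> \bar R)^nat, (forall n, measurable_fun setT (f n)) ->
    (forall n x, 0 <= f n x) ->
    (forall x, {homo f ^~ x : m n / (m <= n)%N >-> m <= n}) ->
    (forall n, Q (f n)) -> Q (fun x => limn (f ^~ x))) ->
  forall f, measurable_fun setT f -> (forall x, 0 <= f x) -> Q f.
Proof.
move=> Qindic QD QZ Qlim f mf f0.
have Qsum (h : {nnsfun T >-> R}) (s : seq R) : (forall r, r \in s -> (0 <= r)%R) ->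
    Q (fun x => \sum_(r <- s) (r%:E * (\1_(h @^-1` [set r]) x)%:E)).
  elim: s => [_|r s ih rs].
    rewrite (_ : (fun _ => _) = (fun x : T => (\1_set0 x)%:E)); first exact: Qindic.
    by apply/funext => x; rewrite big_nil indic0.
  have r0 : (0 <= r)%R by rewrite rs// mem_head.
  have s0 u : u \in s -> (0 <= u)%R by move=> us; rewrite rs// inE us orbT.
  under eq_fun do rewrite big_cons.
  have m1 u : measurable_fun setT (fun x => (\1_(h @^-1` [set u]) x)%:E : \bar R).
    exact/measurable_EFinP.
  apply: QD.
  - exact: measurable_funeM.
  - by move=> x; rewrite mule_ge0// lee_fin.
  - by apply: emeasurable_sum => u; exact: measurable_funeM.
  - move=> x; rewrite big_seq sume_ge0// => u us.
    by rewrite mule_ge0// lee_fin// s0.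
  - by apply: QZ => //; exact: Qindic.
  - exact: ih.
pose g := nnsfun_approx measurableT mf.
rewrite (_ : f = (fun x => limn ((fun n => EFin \o g n) ^~ x))); last first.
  by apply/funext => x; apply/esym/cvg_lim => //; exact: cvg_nnsfun_approx.
apply: Qlim.
- by move=> n; exact/measurable_EFinP.
- by move=> n x; rewrite lee_fin.
- by move=> x m n mn; rewrite lee_fin; exact/lefP/nd_nnsfun_approx.
- move=> n.
  rewrite (_ : _ \o _ = (fun x => \sum_(r <- finmap.enum_fset (fset_set (range (g n))))
      (r%:E * (\1_(g n @^-1` [set r]) x)%:E))).
    by apply: Qsum => r; rewrite in_fset_set// inE => -[x _ <-].
  apply/funext => x /=; rewrite fimfunE fsbig_finite//= -sumEFin.
  by apply: eq_bigr.
Qed.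

End function_induction.

Lemma ge0_fubini_in d1 d2 (T1 : measurableType d1) (T2 : measurableType d2)
    (R : realType) (m1 : {sigma_finite_measure set T1 -> \bar R})
    (m2 : {sigma_finite_measure set T2 -> \bar R}) (D : set T1)
    (k : T1 * T2 -> \bar R) :
  measurable D -> measurable_fun setT k -> (forall p, 0 <= k p) ->
  \int[m2]_y \int[m1]_(x in D) k (x, y) = \int[m1]_(x in D) \int[m2]_y k (x, y).
Proof.
move=> mD mk k0; set K := k \_ (D `*` setT).
have mK : measurable_fun setT K.
  apply/(measurable_restrictT _ (measurableX mD measurableT)).
  exact: (@measurable_funS _ _ _ _ setT).
have K0 p : 0 <= K p by rewrite /K patchE; case: ifP.
have KE x y : K (x, y) = if x \in D then k (x, y) else 0.
  rewrite /K patchE; congr (if _ then _ else _).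
  by apply/idP/idP; rewrite !inE => //= -[].
rewrite [RHS]integral_mkcond.
transitivity (\int[m1]_x \int[m2]_y K (x, y)).
  rewrite fubini_tonelli//; apply: eq_integral => y _.
  by rewrite integral_mkcond; apply: eq_integral => x _; rewrite KE patchE.
apply: eq_integral => x _; rewrite patchE; under eq_integral do rewrite KE.
by case: ifP => // _; rewrite integral0.
Qed.

Lemma ge0_kernel_fubini d1 d2 d3 (T1 : measurableType d1)
    (E : measurableType d2) (T2 : measurableType d3)
    (R : realType) (m1 : {sigma_finite_measure set T1 -> \bar R})
    (P : R.-pker E ~> T2) (x : E) (D : set T1) (k : T1 * T2 -> \bar R) :
  measurable D -> measurable_fun setT k -> (forall p, 0 <= k p) ->
  \int[P x]_w \int[m1]_(t in D) k (t, w) = \int[m1]_(t in D) \int[P x]_w k (t, w).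
Proof.
have sfin : sigma_finite setT (P x).
  apply: fin_num_fun_sigma_finite; first by rewrite measure0.
  exact: finite_kernel_measure.
pose H1 := isSFinite.Build _ _ _ _ (sfinite_measure_sigma_finite sfin).
pose H2 := isSigmaFinite.Build _ _ _ _ sfin.
pose Px := HB.pack_for {sigma_finite_measure set T2 -> \bar R}
  (Measure.sort (P x)) H1 H2.
exact: (@ge0_fubini_in _ _ _ _ _ m1 Px).
Qed.

Section kernel_snd.
Context d1 d2 d3 (T1 : measurableType d1) (E : measurableType d2)
  (T2 : measurableType d3) (R : realType) (P : R.-pker E ~> T2).

(** The kernel [P] with an additional idle parameter: integrating against it
    gives measurability in the parameter and the starting point jointly. *)
Definition kernel_snd (p : T1 * E) : {measure set T2 -> \bar R} := P p.2.

Let measurable_kernel_snd U : measurable U ->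
  measurable_fun setT (kernel_snd ^~ U).
Proof.
by move=> mU; exact: measurableT_comp (measurable_kernel P U mU) measurable_snd.
Qed.

HB.instance Definition _ :=
  isKernel.Build _ _ _ _ R kernel_snd measurable_kernel_snd.

Let kernel_snd_prob p : kernel_snd p setT = 1.
Proof. exact: prob_kernel. Qed.

HB.instance Definition _ :=
  Kernel_isProbability.Build _ _ _ _ R kernel_snd kernel_snd_prob.

Lemma measurable_fun_kernel_integral (k : T1 * T2 -> \bar R) :
  measurable_fun setT k -> (forall p, 0 <= k p) ->
  measurable_fun setT (fun p : T1 * E => \int[P p.2]_w k (p.1, w)).
Proof.
move=> mk k0.
apply: (measurable_fun_integral_finite_kernel
  (fun q : (T1 * E) * T2 => k (q.1.1, q.2)) kernel_snd).
- by [].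
- apply: (measurableT_comp mk).
  apply/measurable_fun_pair => /=; last exact: measurable_snd.
  by apply: measurableT_comp; exact: measurable_fst.
Qed.

End kernel_snd.

(** * The Markov property for nonnegative functions *)

(** The factor [k] may be infinite.  Continuity of multiplication then only holds
    away from the limit [0], but a nondecreasing nonnegative sequence with limit
    [0] vanishes identically. *)
Lemma ge0_nondecreasing_limeZr (R : realType) (f : (\bar R)^nat) (k : \bar R) :
  (forall n, 0 <= f n) -> {homo f : m n / (m <= n)%N >-> m <= n} -> 0 <= k ->
  limn (fun n => f n * k) = limn f * k.
Proof.
move=> f0 ndf k0.
have cf : f @ \oo --> limn f by exact: ereal_nondecreasing_is_cvgn.
case: k k0 => [k| |//] k0; first exact/cvg_lim/cvgeZr.
have [[n fn0]|f_eq0] := pselect (exists n, f n != 0).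
  apply/cvg_lim => //; apply: cvgeM => //; last exact: cvg_cst.
  have : 0 < limn f.
    apply: (@lt_le_trans _ _ (f n)); first by rewrite lt0e fn0 f0.
    by rewrite (cvg_lim _ (ereal_nondecreasing_cvgn ndf))//; exact: ereal_sup_ubound.
  by move=> f_gt0; apply: mule_def_neq0_infty; rewrite // gt_eqF.
have -> : f = cst 0.
  by apply/funext => n; apply/eqP; apply: contrapT => /negP fn0; apply: f_eq0; exists n.
have lim0 : limn (cst 0 : (\bar R)^nat) = 0 by apply: cvg_lim => //; exact: cvg_cst.
transitivity (limn (cst 0 : (\bar R)^nat)).
  by congr (limn _); apply/funext => n; rewrite /= mul0e.
by rewrite lim0 mul0e.
Qed.

Section markov_property.
Context (dO : measure_display) (Omega : measurableType dO) (R : realType)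
  (dE : measure_display) (E : measurableType dE).
Variables (P : R.-pker E ~> Omega) (X : R -> Omega -> E).
Hypothesis hX : homogeneous_markov P X.
Local Notation mu := (@lebesgue_measure R).
Local Notation mR := (measurableTypeR R).

Let mX t : (0 <= t)%R -> measurable_fun setT (X t).
Proof. by case: hX => + _ _; exact. Qed.

Let mphiX phi t : measurable_fun setT phi -> (0 <= t)%R ->
  measurable_fun setT (fun w => phi (X t w) : \bar R).
Proof. by move=> mphi t0; exact: measurableT_comp mphi (mX t0). Qed.

Definition transition (t : R) (phi : E -> \bar R) (y : E) : \bar R :=
  \int[P y]_w phi (X t w).

Lemma transition_ge0 t phi y : (forall z, 0 <= phi z) -> 0 <= transition t phi y.
Proof. by move=> phi0; exact: integral_ge0. Qed.

Lemma measurable_transition t phi : (0 <= t)%R ->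
  measurable_fun setT phi -> (forall y, 0 <= phi y) ->
  measurable_fun setT (transition t phi).
Proof.
move=> t0 mphi phi0.
apply: (measurable_fun_integral_finite_kernel (fun q => phi (X t q.2)) P) => //.
by apply: (measurableT_comp (mphiX mphi t0)); exact: measurable_snd.
Qed.

Lemma natural_filtration_measurable s : natural_filtration X s `<=` measurable.
Proof.
apply: smallest_sub; first exact: sigma_algebra_measurable.
move=> A [u /=]; rewrite in_itv/= => /andP[u0 _] [B mB <-].
exact: mX.
Qed.

(** The hypothesis on the process is the case where [phi] is an indicator; both
    sides are additive, homogeneous and continuous along increasing sequences in
    [phi]. *)
Lemma markov_event (x : E) (s t : R) (D : set Omega) (phi : E -> \bar R) :
  (0 <= s)%R -> (0 <= t)%R -> natural_filtration X s D ->
  measurable_fun setT phi -> (forall y, 0 <= phi y) ->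
  \int[P x]_(w in D) phi (X (s + t)%R w) =
  \int[P x]_(w in D) transition t phi (X s w).
Proof.
move=> s0 t0 FD.
have mD : measurable D by exact: natural_filtration_measurable FD.
have st0 : (0 <= s + t)%R by exact: addr_ge0.
have mtX f : measurable_fun setT f -> (forall y, 0 <= f y) ->
    measurable_fun D (fun w => transition t f (X s w)).
  move=> mf f0; apply: measurable_funTS.
  by apply: (measurableT_comp _ (mX s0)); exact: measurable_transition.
move: phi; apply: ge0_measurable_fun_ind.
- move=> B mB.
  rewrite (_ : \int[P x]_(w in D) _ = P x (X (s + t)%R @^-1` B `&` D)).
    case: hX => _ _ /(_ x s t B s0 t0 mB)[_ /(_ D FD)].
    rewrite setIC => <-; apply: eq_integral => w _.
    rewrite /transition.
    rewrite -[X in P _ X]setIT -integral_indic//.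
    by rewrite -[X in measurable X]setTI; exact: mX.
  rewrite -integral_indic//.
  by rewrite -[X in measurable X]setTI; exact: mX.
- move=> f g mf f0 mg g0 IHf IHg.
  rewrite ge0_integralD//; last 2 first.
  + by apply: measurable_funTS; exact: mphiX.
  + by apply: measurable_funTS; exact: mphiX.
  rewrite IHf IHg -ge0_integralD//; last 4 first.
  + by move=> w _; exact: transition_ge0.
  + exact: mtX.
  + by move=> w _; exact: transition_ge0.
  + exact: mtX.
  apply: eq_integral => w _; rewrite /transition ge0_integralD//; exact: mphiX.
- move=> k f k0 mf f0 IHf.
  rewrite ge0_integralZl//; last by apply: measurable_funTS; exact: mphiX.
  rewrite IHf -ge0_integralZl//; last 2 first.
  + exact: mtX.
  + by move=> w _; exact: transition_ge0.
  apply: eq_integral => w _; rewrite /transition ge0_integralZl//; exact: mphiX.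
- move=> f mf f0 ndf IHf.
  rewrite (@monotone_convergence _ _ _ _ _ _ (fun n w => f n (X (s + t)%R w)))//; last first.
    by move=> n; apply: measurable_funTS; exact: mphiX.
  under eq_fun do rewrite IHf.
  rewrite -(@monotone_convergence _ _ _ _ _ _ (fun n w => transition t (f n) (X s w)))//; last 3 first.
  + by move=> n; exact: mtX.
  + by move=> n w _; exact: transition_ge0.
  + move=> w _ m n mn; apply: ge0_le_integral => //; do ?exact: mphiX.
    by move=> v _; exact: ndf.
  apply: eq_integral => w _; rewrite /transition.
  rewrite (@monotone_convergence _ _ _ _ _ _ (fun n v => f n (X t v)))//.
  by move=> n; exact: mphiX.
Qed.

Let measurable_filtrationE s
    (D : set (g_sigma_algebraType (natural_filtration X s))) :
  measurable D = natural_filtration X s D.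
Proof.
rewrite /measurable/= sigma_algebra_id// /natural_filtration.
exact: smallest_sigma_algebra.
Qed.

Lemma measurable_fun_natural_filtration (s : R)
    (Z : g_sigma_algebraType (natural_filtration X s) -> \bar R) :
  measurable_fun setT Z -> measurable_fun setT (Z : Omega -> \bar R).
Proof.
move=> mZ _ Y mY; apply: natural_filtration_measurable.
by rewrite -measurable_filtrationE; exact: mZ.
Qed.

(** Same passage to the limit as in [markov_event], now in the past factor [Z]. *)
Lemma markov_expectation (x : E) (s t : R)
    (Z : g_sigma_algebraType (natural_filtration X s) -> \bar R)
    (phi : E -> \bar R) :
  (0 <= s)%R -> (0 <= t)%R ->
  measurable_fun setT Z -> (forall w, 0 <= Z w) ->
  measurable_fun setT phi -> (forall y, 0 <= phi y) ->
  \int[P x]_w (Z w * phi (X (s + t)%R w)) =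
  \int[P x]_w (Z w * transition t phi (X s w)).
Proof.
move=> s0 t0 mZ Z0 mphi phi0.
have st0 : (0 <= s + t)%R by exact: addr_ge0.
have mL : measurable_fun setT (fun w => phi (X (s + t)%R w)) by exact: mphiX.
have mQ : measurable_fun setT (fun w => transition t phi (X s w)).
  by apply: (measurableT_comp _ (mX s0)); exact: measurable_transition.
have tX0 w : 0 <= transition t phi (X s w) by exact: transition_ge0.
have mnf := @measurable_fun_natural_filtration s.
move: Z mZ Z0; apply: ge0_measurable_fun_ind.
- move=> D mD.
  have FD : natural_filtration X s D.
    by rewrite -measurable_filtrationE.
  have restr (h : Omega -> \bar R) :
      \int[P x]_w ((\1_D w)%:E * h w) = \int[P x]_(w in D) h w.
    rewrite [RHS]integral_mkcond; apply: eq_integral => w _.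
    by rewrite patchE indicE; case: ifP => _; rewrite ?mul1e ?mul0e.
  by rewrite !restr; exact: markov_event.
- move=> f g mf f0 mg g0 IHf IHg.
  have mf' := mnf _ mf; have mg' := mnf _ mg.
  transitivity (\int[P x]_w (f w * phi (X (s + t)%R w) + g w * phi (X (s + t)%R w))).
    by apply: eq_integral => w _; rewrite ge0_muleDl.
  rewrite ge0_integralD//; last 4 first.
  + by move=> w _; exact: mule_ge0.
  + exact: emeasurable_funM.
  + by move=> w _; exact: mule_ge0.
  + exact: emeasurable_funM.
  rewrite IHf IHg -ge0_integralD//; last 4 first.
  + by move=> w _; exact: mule_ge0.
  + exact: emeasurable_funM.
  + by move=> w _; exact: mule_ge0.
  + exact: emeasurable_funM.
  by apply: eq_integral => w _; rewrite ge0_muleDl.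
- move=> k f k0 mf f0 IHf.
  have mf' := mnf _ mf.
  under eq_integral do rewrite -muleA.
  rewrite ge0_integralZl//; last 2 first.
  + exact: emeasurable_funM.
  + by move=> w _; exact: mule_ge0.
  rewrite IHf -ge0_integralZl//; last 2 first.
  + exact: emeasurable_funM.
  + by move=> w _; exact: mule_ge0.
  by apply: eq_integral => w _; rewrite muleA.
- move=> f mf f0 ndf IHf.
  have mf' n := mnf _ (mf n).
  have mc (h : Omega -> \bar R) : measurable_fun setT h -> (forall w, 0 <= h w) ->
      \int[P x]_w (limn (f ^~ w) * h w) = limn (fun n => \int[P x]_w (f n w * h w)).
    move=> mh h0; rewrite -monotone_convergence//.
    - apply: eq_integral => w _; rewrite ge0_nondecreasing_limeZr//; exact: ndf.
    - by move=> n; exact: emeasurable_funM.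
    - by move=> n w _; exact: mule_ge0.
    - by move=> w _ m n mn; apply: lee_pmul => //; exact: ndf.
  rewrite !mc//.
  by under eq_fun do rewrite IHf.
Qed.

End markov_property.

(** * The exponential moment of an additive functional *)

Lemma ge0_integral_shift (R : realType) (F : measurableTypeR R -> \bar R) (s T : R) :
  measurable_fun setT F -> (forall u, 0 <= F u) ->
  \int[lebesgue_measure]_(t in `[s, T]) F (t - s)%R =
  \int[lebesgue_measure]_(u in `[0%R, (T - s)%R]) F u.
Proof.
move=> mF F0.
have mshift : measurable_fun setT (fun t : measurableTypeR R => (t - s)%R : measurableTypeR R).
  exact: measurable_funB.
have shiftE A : measurable A -> @lebesgue_measure R A =
    pushforward lebesgue_measure (fun t : measurableTypeR R => (t - s)%R : measurableTypeR R) A.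
  move=> mA; apply: lebesgue_measure_unique => //= _ [[a b]] _ <-.
  rewrite /pushforward (_ : _ @^-1` _ = `](a + s)%R, (b + s)%R]%classic).
    by rewrite !lebesgue_measure_itv/= !lte_fin ltrD2r -!EFinD opprD addrACA subrr addr0.
  by apply/seteqP; split => t /=; rewrite !in_itv/= ltrBrDr lerBlDr.
rewrite [RHS](@eq_measure_integral _ _ _ _ (pushforward lebesgue_measure
  (fun t : measurableTypeR R => (t - s)%R : measurableTypeR R))); last first.
  by move=> A mA _; exact: shiftE.
rewrite ge0_integral_pushforward//; last exact: measurable_funTS.
congr integral.
by apply/seteqP; split => t /=; rewrite !in_itv/= subr_ge0 lerD2r.
Qed.

Section exponential_moment.
Context (dO : measure_display) (Omega : measurableType dO) (R : realType)
  (dE : measure_display) (E : measurableType dE).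
Variables (P : R.-pker E ~> Omega) (X : R -> Omega -> E).
Hypotheses (hX : homogeneous_markov P X) (mX : measurable_process X).
Variable g : E -> \bar R.
Hypotheses (mg : measurable_fun setT g) (g0 : forall y, 0 <= g y).
Local Notation mu := (@lebesgue_measure R).
Local Notation mR := (measurableTypeR R).

(** The payoff along the path, cut off at negative times, where nothing is known
    about [X]; the cut-off makes it measurable on the whole product. *)
Let H : mR * Omega -> \bar R :=
  (fun p => g (X p.1 p.2)) \_ (`[0%R, +oo[ `*` [set: Omega]).

Let HE (t : R) w : (0 <= t)%R -> H (t, w) = g (X t w).
Proof. by move=> t0; rewrite /H patchE mem_set//=; split => //=; rewrite in_itv/= t0. Qed.

Let mH : measurable_fun setT H.
Proof.
have mD : measurable (`[0%R, +oo[%classic `*` [set: Omega] : set (mR * Omega)).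
  by apply: measurableX => //; exact: measurable_itv.
by apply/(measurable_restrictT _ mD); exact: measurableT_comp mg mX.
Qed.

Let H0 p : 0 <= H p.
Proof. by rewrite /H patchE; case: ifP. Qed.

Let J n t w : \bar R := iterated_integral (fun s => H (s, w)) n t.

Let J0 n t w : 0 <= J n t w.
Proof. exact: iterated_integral_ge0. Qed.

Let mJ n : measurable_fun setT (fun p : mR * Omega => J n p.1 p.2).
Proof. exact: measurable_iterated_integral. Qed.

Let msec (F : mR * Omega -> \bar R) t :
  measurable_fun setT F -> measurable_fun setT (fun w => F (t, w)).
Proof.
by move=> mF; apply: (measurableT_comp mF); exact: measurable_fun_pair.
Qed.

Let msect (F : mR * Omega -> \bar R) w :
  measurable_fun setT F -> measurable_fun setT (fun t : mR => F (t, w)).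
Proof.
move=> mF; apply: (measurableT_comp mF (g := fun t : mR => (t, w))).
exact: measurable_fun_pair.
Qed.

Let mJt n t : measurable_fun setT (J n t).
Proof. exact: msec (mJ n). Qed.

Lemma measurable_fun_past_payoff (s u : R) : (0 <= u)%R -> (u <= s)%R ->
  measurable_fun setT
    ((fun w => g (X u w)) : g_sigma_algebraType (natural_filtration X s) -> \bar R).
Proof.
move=> u0 us _ Y mY.
apply: sub_sigma_algebra; apply: sub_sigma_algebra; exists u.
  by rewrite /= in_itv/= u0 us.
exists (g @^-1` Y) => //.
by rewrite -[X in measurable X]setTI; exact: mg.
Qed.

(** The factor [J n v] depends only on the path before time [s], yet joint
    measurability of the process does not make it measurable for the natural
    filtration at time [s] (which is not completed), so [markov_expectation] does
    not apply to it.  The Markov identity still passes through: by Tonelli it is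
    enough to have it at each fixed value of the integration times, where the
    extra factors [g (X u)] with [u <= s] are measurable with respect to the past
    and are absorbed into [Z]. *)
Lemma markov_iterated_integral x n (s t v : R)
    (Z : g_sigma_algebraType (natural_filtration X s) -> \bar R)
    (phi : E -> \bar R) :
  (0 <= s)%R -> (0 <= t)%R -> (v <= s)%R ->
  measurable_fun setT Z -> (forall w, 0 <= Z w) ->
  measurable_fun setT phi -> (forall y, 0 <= phi y) ->
  \int[P x]_w (J n v w * (Z w * phi (X (s + t)%R w))) =
  \int[P x]_w (J n v w * (Z w * transition P X t phi (X s w))).
Proof.
move=> s0 t0 + + + mphi phi0.
elim: n v Z => [v Z _ mZ Z0|n ih v Z vs mZ Z0].
  under eq_integral do rewrite mul1e.
  under [RHS]eq_integral do rewrite mul1e.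
  exact: markov_expectation.
have mZ' := measurable_fun_natural_filtration hX mZ.
(* Tonelli in the latest integration time u; g (X u) joins the past factor Z. *)
have step (Y : Omega -> \bar R) : measurable_fun setT Y -> (forall w, 0 <= Y w) ->
    \int[P x]_w (J n.+1 v w * (Z w * Y w)) =
    \int[mu]_(u in `[0%R, v]) \int[P x]_w (J n u w * ((g (X u w) * Z w) * Y w)).
  move=> mY Y0.
  have mk : measurable_fun setT (fun p : mR * Omega =>
      J n p.1 p.2 * H p * (Z p.2 * Y p.2)).
    apply: emeasurable_funM; first exact: emeasurable_funM.
    have mZY : measurable_fun setT (fun w : Omega => Z w * Y w).
      exact: (emeasurable_funM mZ').
    exact: measurableT_comp mZY measurable_snd.
  have k0 p : 0 <= J n p.1 p.2 * H p * (Z p.2 * Y p.2).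
    by rewrite mule_ge0 ?mule_ge0.
  transitivity (\int[mu]_(u in `[0%R, v]) \int[P x]_w (J n u w * H (u, w) * (Z w * Y w))).
    rewrite -(@ge0_kernel_fubini _ _ _ _ _ _ _ mu P x _ _ _ mk k0)//=; apply: eq_integral => w _ /=.
    rewrite ge0_integralZr//.
    - apply: measurable_funTS; apply: emeasurable_funM.
        apply: (measurableT_comp (mJ n) (g := fun t : mR => (t, w))).
        exact: measurable_fun_pair.
      by apply: (measurableT_comp mH); exact: measurable_fun_pair.
    - by move=> u _; exact: mule_ge0.
    - exact: mule_ge0.
  apply: eq_integral => u; rewrite inE/= in_itv/= => /andP[u0 _].
  by apply: eq_integral => w _; rewrite HE// !muleA.
have st0 : (0 <= s + t)%R by exact: addr_ge0.
have mXr r : (0 <= r)%R -> measurable_fun setT (X r) by case: hX => + _ _; exact.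
have mphiX : measurable_fun setT (fun w => phi (X (s + t)%R w)).
  exact: measurableT_comp mphi (mXr _ st0).
have mtX : measurable_fun setT (fun w => transition P X t phi (X s w)).
  exact: measurableT_comp (measurable_transition hX t0 mphi phi0) (mXr _ s0).
have tX0 w : 0 <= transition P X t phi (X s w) by exact: transition_ge0.
have e1 := step (fun w => phi (X (s + t)%R w)) mphiX (fun w => phi0 _).
have e2 := step (fun w => transition P X t phi (X s w)) mtX tX0.
apply: (etrans e1); apply: (etrans _ (esym e2)).
apply: eq_integral => u; rewrite inE/= in_itv/= => /andP[u0 uv].
have us := le_trans uv vs.
apply: (ih u (fun w => g (X u w) * Z w)) => //.
- by apply: emeasurable_funM => //; exact: measurable_fun_past_payoff.
- by move=> w; exact: mule_ge0.
Qed.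

Section bounded_occupation.
Variables (T : R) (c : R).
Hypothesis c0 : (0 <= c)%R.
Hypothesis hc : forall y, g y != 0 ->
  \int[P y]_w \int[mu]_(t in `[0%R, T]) g (X t w) <= c%:E.

(** The expected payoff at time [p.1] for the process started at [p.2]. *)
Let q (p : mR * E) : \bar R := \int[P p.2]_w H (p.1, w).

Let mq : measurable_fun setT q.
Proof. exact: measurable_fun_kernel_integral. Qed.

Let q0 p : 0 <= q p.
Proof. exact: integral_ge0. Qed.

(** Shifting time by [s] turns the left-hand side into the expected occupation
    up to time [T - s], at most the one up to time [T]. *)
Let q_le (s : R) y : (0 <= s)%R -> g y != 0 ->
  \int[mu]_(t in `[s, T]) q ((t - s)%R, y) <= c%:E.
Proof.
move=> s0 gy.
have mqy : measurable_fun setT (fun u : mR => q (u, y)).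
  by apply: (measurableT_comp mq); exact: measurable_fun_pair.
rewrite (ge0_integral_shift _ _ mqy)//.
apply: (@le_trans _ _ (\int[mu]_(u in `[0%R, T]) q (u, y))).
  apply: ge0_subset_integral => //; first exact: measurable_funTS.
  apply: subset_itvl; rewrite bnd_simp lerBlDr lerDl//.
apply: le_trans (hc gy); rewrite -(@ge0_kernel_fubini _ _ _ _ _ _ _ mu P y _ _ _ mH H0)//.
rewrite le_eqVlt; apply/orP; left; apply/eqP; apply: eq_integral => w _.
by apply: eq_integral => t; rewrite inE/= in_itv/= => /andP[t0 _]; exact: HE.
Qed.

(** The integrand whose time integral is [J n.+1]. *)
Let JH n (s : R) w := J n s w * H (s, w).

Let JH0 n s w : 0 <= JH n s w.
Proof. exact: mule_ge0. Qed.

Let mJH n : measurable_fun setT (fun p : mR * Omega => JH n p.1 p.2).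
Proof. by apply: emeasurable_funM; [exact: mJ|exact: mH]. Qed.

Let mHs w : measurable_fun setT (fun t : mR => H (t, w)).
Proof. exact: msect mH. Qed.

(** At time [s] the factor [H (s, _)] vanishes unless [g (X s)] is nonzero; in
    that case, by the Markov property, the expected payoff still to come is that of
    the process restarted from [X s], which [hc] bounds by [c]. *)
Lemma ge0_integral_future_payoff_le x n (s : R) : (0 <= s)%R ->
  \int[P x]_w (JH n s w * \int[mu]_(t in `[s, T]) H (t, w)) <=
  c%:E * \int[P x]_w JH n s w.
Proof.
move=> s0.
have mJHs : measurable_fun setT (JH n s) by exact: msec (mJH n).
have mXs : measurable_fun setT (X s) by case: hX => + _ _; exact.
have mqX : measurable_fun setT (fun p : mR * Omega => q ((p.1 - s)%R, X s p.2)).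
  apply: (measurableT_comp mq); apply/measurable_fun_pair => /=.
    by apply: measurable_funB => //; exact: measurable_fst.
  exact: measurableT_comp mXs measurable_snd.
have mJHs2 : measurable_fun setT (fun p : mR * Omega => JH n s p.2).
  exact: measurableT_comp mJHs measurable_snd.
have mqXw w : measurable_fun setT (fun t : mR => q ((t - s)%R, X s w)).
  exact: (msect w mqX).
have mJq : measurable_fun setT
    (fun p : mR * Omega => JH n s p.2 * q ((p.1 - s)%R, X s p.2)).
  exact: emeasurable_funM.
rewrite [leLHS](_ : _ = \int[P x]_w \int[mu]_(t in `[s, T]) (JH n s w * q ((t - s)%R, X s w))).
  rewrite -ge0_integralZl//; apply: ge0_le_integral => //.
  - by move=> w _; apply: integral_ge0 => t _; exact: mule_ge0.
  - apply: (@measurable_fun_integral_section _ Omega R (snd @^-1` `[s, T])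
      (fun p : Omega * mR => JH n s p.1 * q ((p.2 - s)%R, X s p.1))).
    + by rewrite -[X in measurable X]setTI; exact: measurable_snd.
    + apply: (measurableT_comp mJq (g := fun p : Omega * mR => (p.2, p.1))).
      by apply: measurable_fun_pair; [exact: measurable_snd|exact: measurable_fst].
    + by move=> p; exact: mule_ge0.
  - exact: measurable_funeM.
  (* Where g (X s) = 0 both sides vanish; elsewhere q_le applies. *)
  - move=> w _; rewrite ge0_integralZl//; last exact: measurable_funTS.
    have [gX|gX] := eqVneq (g (X s w)) 0.
      by rewrite /JH HE// gX mule0 mul0e mule0.
    by rewrite muleC; apply: lee_wpmul2r => //; exact: q_le.
transitivity (\int[P x]_w \int[mu]_(t in `[s, T]) (JH n s w * H (t, w))).
  apply: eq_integral => w _; rewrite ge0_integralZl//; exact: measurable_funTS.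
have mJsH : measurable_fun setT (fun p : mR * Omega => JH n s p.2 * H p).
  exact: emeasurable_funM.
have JsH0 (p : mR * Omega) : 0 <= JH n s p.2 * H p by exact: mule_ge0.
have Jq0 (p : mR * Omega) : 0 <= JH n s p.2 * q ((p.1 - s)%R, X s p.2).
  exact: mule_ge0.
have mitv : measurable (`[s, T]%classic : set mR) by [].
apply: (etrans (ge0_kernel_fubini mu P x mitv mJsH JsH0)).
apply: (etrans _ (esym (ge0_kernel_fubini mu P x mitv mJq Jq0))).
apply: eq_integral => t; rewrite inE/= in_itv/= => /andP[st _].
have ts0 : (0 <= t - s)%R by rewrite subr_ge0.
have tE : t = (s + (t - s))%R by rewrite addrC subrK.
transitivity (\int[P x]_w (J n s w * (g (X s w) * g (X (s + (t - s))%R w)))).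
  by apply: eq_integral => w _; rewrite -tE /JH !HE// ?muleA// (le_trans s0).
rewrite (@markov_iterated_integral x n s (t - s)%R s (fun w => g (X s w)) g)//; last first.
  exact: measurable_fun_past_payoff.
apply: eq_integral => w _; rewrite /JH HE// muleA; congr (_ * _).
by apply: eq_integral => v _; rewrite HE.
Qed.

(** Writing the two latest times of [J n.+2 T] as [s <= t], the triangle formula
    integrates over [t] first; this inner integral is the payoff after time [s],
    and replacing it by the constant [c] leaves [J n.+1 T]. *)
Lemma iterated_integral_expectation_le x n :
  \int[P x]_w J n.+2 T w <= c%:E * \int[P x]_w J n.+1 T w.
Proof.
pose W (p : mR * Omega) := \int[mu]_(t in `[p.1 : R, T]) H (t, p.2).
have W0 p : 0 <= W p by exact: integral_ge0.
have mW : measurable_fun setT W.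
  rewrite (_ : W = (fun p => \int[mu]_(t in [set t | ([set r : (mR * Omega) * mR |
      (r.1.1 <= r.2)%R] `&` [set r | (r.2 <= T)%R]) (p, t)]) H (t, p.2))); last first.
    apply/funext => p; congr integral; apply/seteqP; split => t /=.
      by rewrite in_itv/= => /andP[].
    by rewrite in_itv/= => -[/= -> ->].
  apply: (@measurable_fun_integral_section _ _ R _
    (fun r : (mR * Omega) * mR => H (r.2, r.1.2))) => //.
    apply: measurableI.
      apply: measurable_le_set; last exact: measurable_snd.
      by apply: measurableT_comp; exact: measurable_fst.
    by apply: (measurable_le_set (g := cst T)) => //; exact: measurable_snd.
  apply: (measurableT_comp mH).
  apply/measurable_fun_pair => /=; first exact: measurable_snd.
  by apply: measurableT_comp; [exact: measurable_snd|exact: measurable_fst].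
have mJHw m w : measurable_fun setT (fun s : mR => JH m s w).
  exact: (msect w (mJH m)).
have mint (F : mR * Omega -> \bar R) : measurable_fun setT F -> (forall p, 0 <= F p) ->
    measurable_fun setT (fun s : mR => \int[P x]_w F (s, w)).
  move=> mF F0.
  have mk := measurable_fun_kernel_integral P mF F0.
  by apply: (measurableT_comp mk (g := fun s : mR => (s, x))); exact: measurable_fun_pair.
have mJW : measurable_fun setT (fun p : mR * Omega => JH n p.1 p.2 * W p).
  exact: emeasurable_funM.
have JW0 (p : mR * Omega) : 0 <= JH n p.1 p.2 * W p by exact: mule_ge0.
have mitv : measurable (`[0%R, T]%classic : set mR) by [].
rewrite [leLHS](_ : _ = \int[P x]_w \int[mu]_(s in `[0%R, T]) (JH n s w * W (s, w))).
  rewrite (ge0_kernel_fubini mu P x mitv mJW JW0).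
  rewrite [X in _ * X](ge0_kernel_fubini mu P x mitv (mJH n) (fun p => JH0 n p.1 p.2)).
  rewrite -ge0_integralZl//; last 2 first.
  - by apply: measurable_funTS; exact: (mint _ (mJH n) (fun p => JH0 n p.1 p.2)).
  - by move=> s _; exact: integral_ge0.
  apply: ge0_le_integral => //.
  - by move=> s _; apply: integral_ge0 => w _; exact: mule_ge0.
  - apply: measurable_funTS; exact: (mint _ mJW JW0).
  - apply: measurable_funTS; apply: measurable_funeM.
    exact: (mint _ (mJH n) (fun p => JH0 n p.1 p.2)).
  - by move=> s; rewrite /= in_itv/= => /andP[s0 _]; exact: ge0_integral_future_payoff_le.
apply: eq_integral => w _.
rewrite [LHS]/J [LHS]/=.
transitivity (\int[mu]_(t in `[0%R, T]) \int[mu]_(s in `[0%R, t]) (JH n s w * H (t, w))).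
  apply: eq_integral => t _; rewrite ge0_integralZr//.
  exact: measurable_funTS.
have mk : measurable_fun setT (fun p : mR * mR => JH n p.1 w * H (p.2, w)).
  apply: emeasurable_funM.
    exact: (measurableT_comp (mJHw n w) measurable_fst).
  exact: (measurableT_comp (mHs w) measurable_snd).
rewrite (ge0_integral_triangle _ mk); last by move=> p; exact: mule_ge0.
apply: eq_integral => s _ /=; rewrite ge0_integralZl//; exact: measurable_funTS.
Qed.

Lemma iterated_integral_expectation_geometric x n :
  \int[P x]_w J n.+1 T w <= (c ^+ n)%:E * \int[P x]_w J 1 T w.
Proof.
elim: n => [|n ih]; first by rewrite expr0 mul1e.
apply: (le_trans (iterated_integral_expectation_le x n)).
rewrite exprS EFinM -muleA; apply: lee_wpmul2l => //.
Qed.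

(** Khasminskii's lemma on an arbitrary measurable state space: the expectation
    of the exponential series is dominated, from index 1 on, by a geometric series
    of ratio [c]. *)
Theorem expectation_expeR_le x : (c < 1)%R ->
  \int[P x]_w expeR (\int[mu]_(t in `[0%R, T]) g (X t w)) <=
  1 + (1 / (1 - c))%:E * \int[P x]_w \int[mu]_(t in `[0%R, T]) g (X t w).
Proof.
move=> c1.
have occE w : \int[mu]_(t in `[0%R, T]) g (X t w) = \int[mu]_(t in `[0%R, T]) H (t, w).
  by apply: eq_integral => t; rewrite inE/= in_itv/= => /andP[t0 _]; rewrite HE.
under eq_integral do rewrite occE expeR_iterated_integral//.
rewrite integral_nneseries//; last 2 first.
- by move=> n; exact: mJt.
- by move=> n w _; exact: J0.
under [X in _ + _ * X]eq_integral do rewrite occE -iterated_integral1.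
set a := fun n => \int[P x]_w J n T w.
have a0 n : 0 <= a n by exact: integral_ge0.
rewrite -/(a 1%N).
apply: lime_le; first by apply: is_cvg_nneseries => n _ _; exact: a0.
apply: nearW => k.
apply: (@le_trans _ _ (\sum_(0 <= i < k.+1) a i)).
  by rewrite big_nat_recr//= leeDl.
rewrite big_nat_recl//= leeD//.
  rewrite /a /J/= integral_cst// mul1e.
  by rewrite (_ : P x setT = 1)//; exact: prob_kernel.
apply: (@le_trans _ _ (\sum_(0 <= i < k) ((c ^+ i)%:E * a 1%N))).
  by apply: lee_sum => i _; exact: iterated_integral_expectation_geometric.
rewrite -ge0_sume_distrl; last by move=> i _; rewrite lee_fin exprn_ge0.
apply: lee_wpmul2r => //; rewrite sumEFin lee_fin big_mkord.
have c1' : (0 < 1 - c)%R by rewrite subr_gt0.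
rewrite ler_pdivlMr// mulrC -opprB mulNr -subrX1 opprB lerBlDr lerDl.
exact: exprn_ge0.
Qed.

End bounded_occupation.

End exponential_moment.

Local Close Scope ereal_scope.

(** * The functional of the ball *)

Lemma measurable_euclidean_ball (R : realType) (d : nat) (r : R) :
  measurable (@euclidean_ball R d r).
Proof.
pose N (y : 'rV[R]_d) : R := Num.sqrt (\sum_(i < d) y ord0 i ^+ 2).
have csq (i : 'I_d) : continuous (fun y : 'rV[R]_d => y ord0 i ^+ 2).
  move=> y; apply: (@continuous_comp _ _ _ (fun y : 'rV[R]_d => y ord0 i)
    (fun u : R => u ^+ 2)); first exact: coord_continuous.
  exact: exprn_continuous.
have csum : continuous (fun y : 'rV[R]_d => \sum_(i < d) y ord0 i ^+ 2).
  move=> y; apply: cvg_big => [| |i _]; [exact: add_continuous|exact: nbhs_filter|].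
  exact: csq.
have cN : continuous N.
  move=> y; apply: (@continuous_comp _ _ _
    (fun y : 'rV[R]_d => \sum_(i < d) y ord0 i ^+ 2) (@Num.sqrt R)).
    exact: csum.
  exact: sqrt_continuous.
have oN : open (N @^-1` [set u | r < u]).
  by apply: open_comp => [y _|]; [exact: cN|exact: open_gt].
rewrite -[X in measurable X]setCK; apply: measurableC; apply: sub_sigma_algebra.
rewrite (_ : ~` _ = N @^-1` [set u | r < u])//.
by apply/seteqP; split => x /=; rewrite /euclidean_ball/= ltNge => /negP.
Qed.

Theorem lemma2p3 (R : realType) (d : nat)
    (dO : measure_display) (Omega : measurableType dO)
    (P : R.-pker (borel_space R d) ~> Omega)
    (X : R -> Omega -> borel_space R d)
    (hX : homogeneous_markov P X) (mX : measurable_process X)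
    (f : borel_space R d -> R) (mf : measurable_fun setT f)
    (f_ge0 : forall x, 0 <= f x)
    (T r : R) (hT : 0 < T) (hr : 0 < r) (c : R)
    (hc : ereal_sup [set (\int[P x]_w ball_occupation X f T r w)%E
                    | x in @euclidean_ball R d r] = c%:E)
    (c_lt1 : c < 1) (x : borel_space R d) :
  (\int[P x]_w expeR (ball_occupation X f T r w)
   <= 1 + (1 / (1 - c))%:E * \int[P x]_w ball_occupation X f T r w)%E.
Proof.
have occ_ge0 w : (0 <= ball_occupation X f T r w)%E.
  by apply: integral_ge0 => t _; rewrite lee_fin mulr_ge0.
have le_c y : euclidean_ball r y ->
    (\int[P y]_w ball_occupation X f T r w <= c%:E)%E.
  by move=> yr; rewrite -hc; apply: ereal_sup_ubound; exists y.
(* The origin lies in the ball, so the supremum is over a nonempty set. *)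
have c_ge0 : 0 <= c.
  have b0 : @euclidean_ball R d r (0 : 'rV[R]_d).
    rewrite /euclidean_ball/= /euclidean_norm big1 ?sqrtr0 ?ltW// => i _.
    by rewrite mxE expr0n.
  by rewrite -lee_fin (le_trans _ (le_c _ b0))// integral_ge0.
pose g y : \bar R := (f y * \1_(euclidean_ball r) y)%:E.
have mg : measurable_fun setT g.
  apply/measurable_EFinP; apply: measurable_funM => //.
  by apply: measurable_indic; exact: measurable_euclidean_ball.
have g_ge0 y : (0 <= g y)%E by rewrite lee_fin mulr_ge0.
have g_ball y : (g y != 0)%E -> (\int[P y]_w \int[lebesgue_measure]_(t in `[0%R, T])
    g (X t w) <= c%:E)%E.
  rewrite /g indicE; case: (boolP (y \in _)) => [|_]; last by rewrite mulr0 eqxx.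
  by rewrite inE => yr _; exact: le_c.
exact: (expectation_expeR_le hX mX mg g_ge0 c_ge0 g_ball).
Qed.
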